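(* Let $\mu$ be the monotone dependence measure (defined in the context). If $X$ and $Y$ are continuous random variables (i.e. with continuous distribution functions) with unique underlying copula $C$, then: (a) $\mu_{X,Y}=\mu(C)=4\Big(\max_{\mathbb{I}^2}\{C-\Pi\}-\max_{\mathbb{I}^2}\{\Pi-C\}\Big)$; (b) $\mu$ is a measure of concordance.
   Context: Let $\mathbb{I}=[0,1]$ and $\overline{\mathbb{R}}=[-\infty,+\infty]$. A (bivariate) subcopula is a function $S:D_1\times D_2\to\mathbb{I}$, where $\{0,1\}\subseteq D_i\subseteq\mathbb{I}$ for $i=1,2$, such that for all $u,u_1,u_2\in D_1$ and $v,v_1,v_2\in D_2$: (i) $S(u,0)=0=S(0,v)$; (ii) $S(u,1)=u$ and $S(1,v)=v$; (iii) $S(u_2,v_2)-S(u_2,v_1)-S(u_1,v_2)+S(u_1,v_1)\ge 0$ whenever $u_1\le u_2$ and $v_1\le v_2$. Write $\mathrm{Dom}\,S=D_1\times D_2$. A copula is a subcopula with domain $\mathbb{I}^2$. Distribution functions are defined on $\overline{\mathbb{R}}$ (with $F_X(-\infty)=0$, $F_X(+\infty)=1$). By Sklar's theorem, for every random vector $(X,Y)$ there is a unique subcopula $S$ with domain $\mathrm{Ran}\,F_X\times\mathrm{Ran}\,F_Y$ such that $F_{X,Y}(x,y)=S(F_X(x),F_Y(y))$ for all $x,y\in\overline{\mathbb{R}}$, called the underlying subcopula of $(X,Y)$. If $X$ and $Y$ are continuous, the domain is $\mathbb{I}^2$ and $S$ is a copula. On $\mathbb{I}^2$ let $W(u,v)=\max\{u+v-1,0\}$,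 $M(u,v)=\min\{u,v\}$, $\Pi(u,v)=uv$; for a subcopula $S$, $W_S,M_S,\Pi_S$ denote the restrictions of $W,M,\Pi$ to $\mathrm{Dom}\,S$. For a subcopula $S$ define $$d(S)=\sup_{\mathrm{Dom}\,S}\{S-\Pi_S\}-\sup_{\mathrm{Dom}\,S}\{\Pi_S-S\}.$$ The monotone dependence measure of a subcopula $S$ is $$\mu(S)=\begin{cases} d(S)/d(M_S) & \text{if } d(S)\ge 0 \text{ and } M_S\ne\Pi_S,\\ -d(S)/d(W_S) & \text{if } d(S)\le 0\text{ and } W_S\neq\Pi_S,\\ 0 & \text{if } W_S=\Pi_S=M_S,\end{cases}$$ and for random variables $X,Y$ with underlying subcopula $S$ one sets $\mu_{X,Y}=\mu(S)$. A numeric measure of association $\kappa$ between two continuous random variables $X,Y$ with copula $C$ (written $\kappa_{X,Y}$ or $\kappa(C)$) is a measure of concordance (Nelsen 2006, Definition 5.1.7, after Scarsini) if: (1) $\kappa$ is defined for every pair $X,Y$ of continuous random variables; (2) $-1\le\kappa_{X,Y}\le 1$, $\kappa_{X,X}=1$, $\kappa_{X,-X}=-1$; (3) $\kappa_{X,Y}=\kappa_{Y,X}$; (4) if $X$ and $Y$ are independent then $\kappa_{X,Y}=0$; (5) $\kappa_{-X,Y}=\kappa_{X,-Y}=-\kappa_{X,Y}$; (6) if $C_1,C_2$ are copulas with $C_1(u,v)\le C_2(u,v)$ for all $(u,v)\in\mathbb{I}^2$ then $\kappa(C_1)\le\kappa(C_2)$; (7) if $\{(X_n,Y_n)\}$ is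 a sequence of pairs of continuous random variables with copulas $C_n$, and $C_n$ converges pointwise to $C$, then $\lim_{n\to\infty}\kappa(C_n)=\kappa(C)$. *)

(* Defs.v *)
From HB Require Import structures.
From mathcomp Require Import all_boot all_order all_algebra.
From mathcomp Require Import all_classical all_reals all_analysis.
From mathcomp Require Import measurable_realfun.
Set Implicit Arguments.
Unset Strict Implicit.
Unset Printing Implicit Defensive.
Import Order.TTheory GRing.Theory Num.Theory.
Import numFieldNormedType.Exports.
Local Open Scope classical_set_scope.
Local Open Scope ring_scope.

(* A function on D1 x D2 is represented by a total function R -> R -> R of which
   only the values on D1 x D2 are ever used. *)
Record is_subcopula (R : realType) (D1 D2 : set R) (S : R -> R -> R) : Prop := {
  subcop_dom1 : [set 0; 1] `<=` D1 /\ D1 `<=` `[0, 1]%classic;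
  subcop_dom2 : [set 0; 1] `<=` D2 /\ D2 `<=` `[0, 1]%classic;
  subcop_range : forall u v, D1 u -> D2 v -> 0 <= S u v <= 1;
  subcop_grounded :
    (forall u, D1 u -> S u 0 = 0) /\ (forall v, D2 v -> S 0 v = 0);
  subcop_margins :
    (forall u, D1 u -> S u 1 = u) /\ (forall v, D2 v -> S 1 v = v);
  subcop_2increasing : forall u1 u2 v1 v2, D1 u1 -> D1 u2 -> D2 v1 -> D2 v2 ->
    u1 <= u2 -> v1 <= v2 -> 0 <= S u2 v2 - S u2 v1 - S u1 v2 + S u1 v1 }.

Record subcopula (R : realType) := Subcopula {
  dom1 : set R;
  dom2 : set R;
  subcop_fun :> R -> R -> R;
  subcopP : is_subcopula dom1 dom2 subcop_fun }.

Record copula (R : realType) := Copula {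
  copula_subcopula :> subcopula R;
  copula_dom1 : dom1 copula_subcopula = `[0, 1]%classic;
  copula_dom2 : dom2 copula_subcopula = `[0, 1]%classic }.

Definition Wcop (R : realType) (u v : R) : R := Num.max (u + v - 1) 0.
Definition Mcop (R : realType) (u v : R) : R := Num.min u v.
Definition Picop (R : realType) (u v : R) : R := u * v.

(* d(f) for f on D1 x D2; W_S, M_S and Pi_S are Wcop, Mcop and Picop taken
   with the domain of S. *)
Definition dep (R : realType) (D1 D2 : set R) (f : R -> R -> R) : R :=
  sup [set f u v - Picop u v | u in D1 & v in D2]
  - sup [set Picop u v - f u v | u in D1 & v in D2].

Definition eq_on (R : realType) (D1 D2 : set R) (f g : R -> R -> R) : Prop :=
  forall u v, D1 u -> D2 v -> f u v = g u v.

(* The two overlapping cases both give 0 when d(S) = 0. The last branch is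
   exactly W_S = Pi_S = M_S: each of M_S = Pi_S and W_S = Pi_S holds if and only
   if D1 = {0, 1} or D2 = {0, 1}. *)
Definition mu (R : realType) (S : subcopula R) : R :=
  let D1 := dom1 S in let D2 := dom2 S in
  if (0 <= dep D1 D2 S) && ~~ `[< eq_on D1 D2 (@Mcop R) (@Picop R) >] then
    dep D1 D2 S / dep D1 D2 (@Mcop R)
  else if (dep D1 D2 S <= 0) && ~~ `[< eq_on D1 D2 (@Wcop R) (@Picop R) >] then
    - dep D1 D2 S / dep D1 D2 (@Wcop R)
  else 0.

Definition df (R : realType) (d : measure_display) (T : measurableType d)
    (P : probability T R) (X : {RV P >-> R}) (x : \bar R) : R :=
  match x with
  | r%:E => fine (cdf X r)
  | +oo%E => 1
  | -oo%E => 0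
  end.

Definition joint_df (R : realType) (d : measure_display) (T : measurableType d)
    (P : probability T R) (X Y : {RV P >-> R}) (x y : \bar R) : R :=
  fine (P [set t | ((X t)%:E <= x)%E /\ ((Y t)%:E <= y)%E]).

Definition continuous_RV (R : realType) (d : measure_display)
    (T : measurableType d) (P : probability T R) (X : {RV P >-> R}) : Prop :=
  continuous (fun r : R => df X r%:E).

Definition independent_RV (R : realType) (d : measure_display)
    (T : measurableType d) (P : probability T R) (X Y : {RV P >-> R}) : Prop :=
  forall A B : set R, measurable A -> measurable B ->
    P (X @^-1` A `&` Y @^-1` B) = (P (X @^-1` A) * P (Y @^-1` B))%E.

Definition underlying (R : realType) (d : measure_display)
    (T : measurableType d) (P : probability T R) (X Y : {RV P >-> R})
    (S : subcopula R) : Prop :=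
  [/\ dom1 S = range (df X), dom2 S = range (df Y) &
      forall x y : \bar R, joint_df X Y x y = S (df X x) (df Y y)].

(* mu_{X,Y}: the common value of mu(S) over the representatives S of the
   underlying subcopula of (X, Y), which is unique on its domain. *)
Definition mu_RV (R : realType) (d : measure_display) (T : measurableType d)
    (P : probability T R) (X Y : {RV P >-> R}) : R :=
  get [set m | exists2 S : subcopula R, underlying X Y S & m = mu S].

Definition is_maximum (R : realType) (A : set R) (m : R) : Prop :=
  A m /\ ubound A m.

(* kRV X Y and k C stand for kappa_{X,Y} and kappa(C). *)
Record measure_of_concordance (R : realType)
    (kRV : forall (d : measure_display) (T : measurableType d)
             (P : probability T R), {RV P >-> R} -> {RV P >-> R} -> R)
    (k : copula R -> R) : Prop := {
  (* kappa_{X,Y} is defined for all continuous X, Y: a copula C of (X, Y)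
     exists and kappa_{X,Y} = kappa(C), whatever the representative C. *)
  conc_defined : forall (d : measure_display) (T : measurableType d)
      (P : probability T R) (X Y : {RV P >-> R}),
    continuous_RV X -> continuous_RV Y ->
    (exists C : copula R, underlying X Y C) /\
    (forall C : copula R, underlying X Y C -> kRV d T P X Y = k C);
  conc_bounds : forall (d : measure_display) (T : measurableType d)
      (P : probability T R) (X Y : {RV P >-> R}),
    continuous_RV X -> continuous_RV Y -> -1 <= kRV d T P X Y <= 1;
  conc_self : forall (d : measure_display) (T : measurableType d)
      (P : probability T R) (X : {RV P >-> R}),
    continuous_RV X -> kRV d T P X X = 1 /\ kRV d T P X (- X) = -1;
  conc_sym : forall (d : measure_display) (T : measurableType d)
      (P : probability T R) (X Y : {RV P >-> R}),
    continuous_RV X -> continuous_RV Y -> kRV d T P X Y = kRV d T P Y X;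
  conc_indep : forall (d : measure_display) (T : measurableType d)
      (P : probability T R) (X Y : {RV P >-> R}),
    continuous_RV X -> continuous_RV Y -> independent_RV X Y ->
    kRV d T P X Y = 0;
  conc_opp : forall (d : measure_display) (T : measurableType d)
      (P : probability T R) (X Y : {RV P >-> R}),
    continuous_RV X -> continuous_RV Y ->
    kRV d T P (- X) Y = - kRV d T P X Y /\
    kRV d T P X (- Y) = - kRV d T P X Y;
  conc_mono : forall C1 C2 : copula R,
    (forall u v : R, u \in `[0, 1] -> v \in `[0, 1] -> C1 u v <= C2 u v) ->
    k C1 <= k C2;
  conc_lim : forall (d_ : nat -> measure_display)
      (T_ : forall n, measurableType (d_ n))
      (P_ : forall n, probability (T_ n) R)
      (X_ Y_ : forall n, {RV (P_ n) >-> R})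
      (C_ : nat -> copula R) (C : copula R),
    (forall n, continuous_RV (X_ n)) -> (forall n, continuous_RV (Y_ n)) ->
    (forall n, underlying (X_ n) (Y_ n) (C_ n)) ->
    (forall u v : R, u \in `[0, 1] -> v \in `[0, 1] ->
      C_ n u v @[n --> \oo] --> C u v) ->
    k (C_ n) @[n --> \oo] --> k C }.

(* Main.v *)
Require Import Defs.
From HB Require Import structures.
From mathcomp Require Import all_boot all_order all_algebra.
From mathcomp Require Import all_classical all_reals all_analysis.
From mathcomp Require Import measurable_realfun.
From mathcomp Require Import ring lra.
Import Order.TTheory GRing.Theory Num.Theory.
Import numFieldNormedType.Exports.
Local Open Scope classical_set_scope.
Local Open Scope ring_scope.

(** On the unit square [d(M) = 1/4] and [d(W) = -1/4], so [mu C = 4 d(C)] for every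
    copula [C]; copulas are 1-Lipschitz in each variable, so the suprema in [d] are
    maxima, and pointwise convergence of copulas is uniform, whence [d] is continuous.
    Monotonicity of [d] in [C] is immediate.  The remaining axioms are statements
    about the copula of a transformed pair: exchanging [X] and [Y] transposes [C],
    and replacing [X] by [-X] turns [C(u, v)] into [v - C(1 - u, v)] (a continuous
    [X] has no atoms), which swaps the two suprema in [d]. *)

Local Notation I01 := (`[0, 1]%classic).

(** * Suprema over products of two sets *)

Section SupImage2.
Context {R : realType} (D1 D2 : set R).
Implicit Types f g : R -> R -> R.

Lemma sup_image2_le f m : D1 !=set0 -> D2 !=set0 ->
  (forall u v, D1 u -> D2 v -> f u v <= m) ->
  sup [set f u v | u in D1 & v in D2] <= m.
Proof.
move=> [a D1a] [b D2b] fm; apply: ge_sup.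
  by exists (f a b); exists a => //; exists b.
by move=> _ [u D1u [v D2v <-]]; exact: fm.
Qed.

Lemma le_sup_image2 f m a b : D1 a -> D2 b ->
  (forall u v, D1 u -> D2 v -> f u v <= m) ->
  f a b <= sup [set f u v | u in D1 & v in D2].
Proof.
move=> D1a D2b fm; apply: ub_le_sup; last by exists a => //; exists b.
by exists m => _ [u D1u [v D2v <-]]; exact: fm.
Qed.

Lemma eq_image2 f g : eq_on D1 D2 f g ->
  [set f u v | u in D1 & v in D2] = [set g u v | u in D1 & v in D2].
Proof.
by move=> fg; apply/seteqP; split => _ [u D1u [v D2v <-]]; exists u => //;
  exists v; rewrite ?fg.
Qed.

Lemma eq_dep f g : eq_on D1 D2 f g -> dep D1 D2 f = dep D1 D2 g.
Proof.
move=> fg; rewrite /dep; congr (sup _ - sup _); apply: eq_image2 => u v Du Dv;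
by rewrite fg.
Qed.

End SupImage2.

Lemma sup_is_maximum (R : realType) (A : set R) m : is_maximum A m -> sup A = m.
Proof.
move=> [Am ubm]; apply/eqP; rewrite eq_le; apply/andP; split.
  by apply: ge_sup => //; exists m.
by apply: ub_le_sup => //; exists m.
Qed.

Lemma image2_transpose (R : realType) (D1 D2 : set R) (f : R -> R -> R) :
  [set f u v | u in D1 & v in D2] = [set f v u | u in D2 & v in D1].
Proof.
by apply/seteqP; split => _ [u Du [v Dv <-]]; exists v => //; exists u.
Qed.

Section UnitSquare.
Context {R : realType}.
Implicit Types f g : R -> R -> R.

Let I01_0 : I01 (0 : R). Proof. by rewrite /= in_itv/= lexx ler01. Qed.
Let I01_1 : I01 (1 : R). Proof. by rewrite /= in_itv/= lexx ler01. Qed.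
Let I01_N0 : (I01 : set R) !=set0. Proof. by exists 0. Qed.

Lemma I01P (u : R) : I01 u -> 0 <= u <= 1.
Proof. by rewrite /= in_itv. Qed.

Lemma I01_onem (u : R) : I01 u -> I01 (1 - u).
Proof. by rewrite /= !in_itv/=; lra. Qed.

(** The extreme value theorem on the compact square, where the Lipschitz bound gives continuity. *)
Lemma lipschitz2_has_maximum f (K : R) :
  (forall u v u' v', I01 u -> I01 v -> I01 u' -> I01 v' ->
     `|f u v - f u' v'| <= K * (`|u - u'| + `|v - v'|)) ->
  exists m, is_maximum [set f u v | u in I01 & v in I01] m.
Proof.
move=> fK; pose A : set (R * R) := I01 `*` I01.
have K0 : 0 <= K.
  have := fK 0 0 1 0 I01_0 I01_0 I01_1 I01_0.
  rewrite subrr normr0 addr0 sub0r normrN normr1 mulr1.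
  exact: le_trans.
have A0 : A !=set0 by exists (0, 0); split; exact: I01_0.
have cA : compact A by apply: compact_setX; exact: segment_compact.
have cf : {within A, continuous (fun z : R * R => f z.1 z.2)}.
  apply/subspace_continuousP => x Ax; apply/cvgrPdist_le => e e0.
  (* Each coordinate contributes at most half of [e]; [K + 1] replaces [K], which may be [0], in the
     denominator. *)
  have d0 : 0 < e / (2 * (K + 1)) by rewrite divr_gt0// mulr_gt0// ltr_wpDl.
  near=> z.
  have [z1 z2] : A z by near: z; exact: withinT.
  have [x1 x2] := Ax.
  apply: le_trans (fK _ _ _ _ x1 x2 z1 z2) _.
  have h : ball x (e / (2 * (K + 1))) z.
    by near: z; apply: cvg_within; exact: nbhsx_ballx.
  have /ltW h1 : `|x.1 - z.1| < e / (2 * (K + 1)) by case: h.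
  have /ltW h2 : `|x.2 - z.2| < e / (2 * (K + 1)) by case: h.
  apply: (@le_trans _ _ ((K + 1) * (e / (2 * (K + 1)) + e / (2 * (K + 1))))).
    by apply: ler_pM; rewrite ?lerDl// ?addr_ge0// lerD.
  rewrite le_eqVlt; apply/orP; left; apply/eqP; field.
  by rewrite gt_eqF// ltr_wpDl.
have [c] := compact_EVT_max A0 cA cf.
rewrite inE => -[c1 c2] cmax; exists (f c.1 c.2); split.
  by exists c.1 => //; exists c.2.
move=> _ [u Du [v Dv <-]].
by apply: (cmax (u, v)); rewrite inE.
Unshelve. all: by end_near. Qed.

(** * Lipschitz continuity and Fréchet-Hoeffding bounds for copulas *)

Section CopulaFunction.
Context f (hf : is_subcopula I01 I01 f).

Lemma cop0r u : I01 u -> f u 0 = 0.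
Proof. exact: (subcop_grounded hf).1. Qed.
Lemma cop0l v : I01 v -> f 0 v = 0.
Proof. exact: (subcop_grounded hf).2. Qed.
Lemma cop1r u : I01 u -> f u 1 = u.
Proof. exact: (subcop_margins hf).1. Qed.
Lemma cop1l v : I01 v -> f 1 v = v.
Proof. exact: (subcop_margins hf).2. Qed.

(** The two inequalities are the nonnegativity of the volumes of [[u1, u2] x [0, v]] and [[u1, u2] x
    [v, 1]]. *)
Lemma cop_increment_l u1 u2 v : I01 u1 -> I01 u2 -> I01 v -> u1 <= u2 ->
  0 <= f u2 v - f u1 v <= u2 - u1.
Proof.
move=> D1 D2 Dv u12; have /andP[v0 v1] := I01P _ Dv.
have := subcop_2increasing hf D1 D2 I01_0 Dv u12 v0.
have := subcop_2increasing hf D1 D2 Dv I01_1 u12 v1.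
by rewrite !cop0r// !cop1r//; lra.
Qed.

Lemma cop_increment_r u v1 v2 : I01 u -> I01 v1 -> I01 v2 -> v1 <= v2 ->
  0 <= f u v2 - f u v1 <= v2 - v1.
Proof.
move=> Du D1 D2 v12; have /andP[u0 u1] := I01P _ Du.
have := subcop_2increasing hf I01_0 Du D1 D2 u0 v12.
have := subcop_2increasing hf Du I01_1 D1 D2 u1 v12.
by rewrite !cop0l// !cop1l//; lra.
Qed.

(** One coordinate moves at a time, through the corner [(u', v)]. *)
Lemma cop_lipschitz u v u' v' : I01 u -> I01 v -> I01 u' -> I01 v' ->
  `|f u v - f u' v'| <= `|u - u'| + `|v - v'|.
Proof.
move=> Du Dv Du' Dv'.
apply: le_trans (ler_distD (f u' v) _ _) _; apply: lerD.
  have [uu'|/ltW uu'] := leP u u'.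
    have /andP[h1 h2] := cop_increment_l _ _ _ Du Du' Dv uu'.
    by rewrite distrC (distrC u) ger0_norm// (le_trans h2)// ler_norm.
  have /andP[h1 h2] := cop_increment_l _ _ _ Du' Du Dv uu'.
  by rewrite ger0_norm// (le_trans h2)// ler_norm.
have [vv'|/ltW vv'] := leP v v'.
  have /andP[h1 h2] := cop_increment_r _ _ _ Du' Dv Dv' vv'.
  by rewrite distrC (distrC v) ger0_norm// (le_trans h2)// ler_norm.
have /andP[h1 h2] := cop_increment_r _ _ _ Du' Dv' Dv vv'.
by rewrite ger0_norm// (le_trans h2)// ler_norm.
Qed.

(** [f] increases up to the sides [v = 1] and [u = 1], where its values are [u] and [v]. *)
Lemma cop_le_Mcop u v : I01 u -> I01 v -> f u v <= Mcop u v.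
Proof.
move=> Du Dv; rewrite /Mcop le_min; apply/andP; split.
  have /andP[_ v1] := I01P _ Dv.
  by have := cop_increment_r _ _ _ Du Dv I01_1 v1; rewrite cop1r//; lra.
have /andP[_ u1] := I01P _ Du.
by have := cop_increment_l _ _ _ Du I01_1 Dv u1; rewrite cop1l//; lra.
Qed.

(** Going from [v] to [1], [f u] gains at most [1 - v] and ends at [u]. *)
Lemma Wcop_le_cop u v : I01 u -> I01 v -> Wcop u v <= f u v.
Proof.
move=> Du Dv; rewrite /Wcop ge_max; apply/andP; split.
  have /andP[_ v1] := I01P _ Dv.
  by have := cop_increment_r _ _ _ Du Dv I01_1 v1; rewrite cop1r//; lra.
by have /andP[] := subcop_range hf Du Dv.
Qed.

End CopulaFunction.

(** * The values of [dep] at [M], [W] and [Pi] *)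

(** With [m] the smaller of [u] and [v], [m - u * v <= m - m ^ 2 <= 1/4], the last step being
    [(m - 1/2) ^ 2 >= 0]. *)
Lemma Mcop_sub_Picop_le (u v : R) : I01 u -> I01 v ->
  Mcop u v - Picop u v <= 4^-1.
Proof.
move=> /I01P/andP[u0 u1] /I01P/andP[v0 v1].
rewrite /Mcop /Picop; case: (leP u v) => [uv|/ltW uv].
- have := mulr_ge0 u0 (ltac:(by rewrite subr_ge0) : 0 <= v - u).
  by have := sqr_ge0 (u - 2^-1); rewrite expr2; lra.
- have := mulr_ge0 v0 (ltac:(by rewrite subr_ge0) : 0 <= u - v).
  by have := sqr_ge0 (v - 2^-1); rewrite expr2; lra.
Qed.

(* [Pi - W] at [(u, v)] is [M - Pi] at [(1 - u, v)]. *)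
Lemma Picop_sub_Wcop_le (u v : R) : I01 u -> I01 v ->
  Picop u v - Wcop u v <= 4^-1.
Proof.
move=> Du Dv; have := Mcop_sub_Picop_le _ _ (I01_onem _ Du) Dv.
rewrite /Mcop /Wcop /Picop; case: (leP (1 - u) v); case: (leP (u + v - 1) 0); lra.
Qed.

Lemma Picop_le_Mcop (u v : R) : I01 u -> I01 v -> Picop u v <= Mcop u v.
Proof.
move=> /I01P/andP[u0 u1] /I01P/andP[v0 v1].
by rewrite /Mcop /Picop le_min ler_piMr// ler_piMl.
Qed.

(** The reflection [u -> 1 - u] again turns this into [Pi <= M]. *)
Lemma Wcop_le_Picop (u v : R) : I01 u -> I01 v -> Wcop u v <= Picop u v.
Proof.
move=> Du Dv; have := Picop_le_Mcop _ _ (I01_onem _ Du) Dv.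
rewrite /Mcop /Wcop /Picop; case: (leP (1 - u) v); case: (leP (u + v - 1) 0); lra.
Qed.

Let I01_half : I01 (2^-1 : R). Proof. by rewrite /= in_itv/=; lra. Qed.

Lemma dep_Mcop : dep I01 I01 (@Mcop R) = 4^-1.
Proof.
rewrite /dep (@sup_is_maximum _ _ 4^-1); last first.
  split; last by move=> _ [u Du [v Dv <-]]; exact: Mcop_sub_Picop_le.
  (* The bound [1/4] is attained at the centre of the square; the other supremum is [0], attained at
     the origin. *)
  by exists 2^-1 => //; exists 2^-1 => //; rewrite /Mcop /Picop minxx; field.
rewrite (@sup_is_maximum _ _ 0) ?subr0//; split.
  by exists 0 => //; exists 0 => //; rewrite /Mcop /Picop minxx mul0r subrr.
by move=> _ [u Du [v Dv <-]]; rewrite subr_le0 Picop_le_Mcop.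
Qed.

Lemma dep_Wcop : dep I01 I01 (@Wcop R) = - 4^-1.
Proof.
rewrite /dep (@sup_is_maximum _ _ 0); last first.
  split; last by move=> _ [u Du [v Dv <-]]; rewrite subr_le0 Wcop_le_Picop.
  exists 0 => //; exists 0 => //.
  by rewrite /Wcop /Picop mul0r !add0r max_r ?subr0// lerN10.
rewrite (@sup_is_maximum _ _ 4^-1) ?sub0r//; split.
  exists 2^-1 => //; exists 2^-1 => //.
  rewrite /Wcop /Picop max_r; first by field.
  by lra.
by move=> _ [u Du [v Dv <-]]; exact: Picop_sub_Wcop_le.
Qed.

Lemma dep_Picop : dep I01 I01 (@Picop R) = 0.
Proof. by rewrite /dep subrr. Qed.

(** * Bounds, monotonicity, continuity and symmetries of [dep] *)

Section Excess.
Context f (hf : is_subcopula I01 I01 f).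

Lemma cop_sub_Picop_le u v : I01 u -> I01 v -> f u v - Picop u v <= 4^-1.
Proof.
move=> Du Dv; apply: le_trans (Mcop_sub_Picop_le _ _ Du Dv).
by rewrite lerB// cop_le_Mcop.
Qed.

Lemma Picop_sub_cop_le u v : I01 u -> I01 v -> Picop u v - f u v <= 4^-1.
Proof.
move=> Du Dv; apply: le_trans (Picop_sub_Wcop_le _ _ Du Dv).
by rewrite lerB// Wcop_le_cop.
Qed.

Lemma cop_sub_Picop_le_sup u v : I01 u -> I01 v ->
  f u v - Picop u v <= sup [set f u v - Picop u v | u in I01 & v in I01].
Proof.
move=> Du Dv; exact: (le_sup_image2 _ _ _ _ _ _ Du Dv cop_sub_Picop_le).
Qed.

Lemma Picop_sub_cop_le_sup u v : I01 u -> I01 v ->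
  Picop u v - f u v <= sup [set Picop u v - f u v | u in I01 & v in I01].
Proof.
move=> Du Dv; exact: (le_sup_image2 _ _ _ _ _ _ Du Dv Picop_sub_cop_le).
Qed.

(** Both suprema lie between [0] and [1/4]: the two differences vanish at the origin. *)
Lemma dep_bounds : - 4^-1 <= dep I01 I01 f <= 4^-1.
Proof.
have := cop_sub_Picop_le_sup _ _ I01_0 I01_0.
have := Picop_sub_cop_le_sup _ _ I01_0 I01_0.
have := sup_image2_le _ _ _ _ I01_N0 I01_N0 cop_sub_Picop_le.
have := sup_image2_le _ _ _ _ I01_N0 I01_N0 Picop_sub_cop_le.
by rewrite /dep (cop0r _ hf)// [Picop 0 0]mul0r; lra.
Qed.

End Excess.

Lemma le_dep f g : is_subcopula I01 I01 f -> is_subcopula I01 I01 g ->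
  (forall u v, I01 u -> I01 v -> f u v <= g u v) ->
  dep I01 I01 f <= dep I01 I01 g.
Proof.
move=> hf hg fg; apply: lerB; apply: sup_image2_le => // u v Du Dv.
  by apply: le_trans (cop_sub_Picop_le_sup _ hg _ _ Du Dv); rewrite lerB// fg.
by apply: le_trans (Picop_sub_cop_le_sup _ hf _ _ Du Dv); rewrite lerB// fg.
Qed.

(** A uniform perturbation by [e] moves each of the two suprema by at most [e]. *)
Lemma dep_dist f g (e : R) : is_subcopula I01 I01 f -> is_subcopula I01 I01 g ->
  (forall u v, I01 u -> I01 v -> `|f u v - g u v| <= e) ->
  `|dep I01 I01 f - dep I01 I01 g| <= 2 * e.
Proof.
(* The one-sided estimate suffices, since the hypothesis is symmetric in the two functions. *)
have half h k : is_subcopula I01 I01 h -> is_subcopula I01 I01 k ->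
    (forall u v, I01 u -> I01 v -> `|h u v - k u v| <= e) ->
    dep I01 I01 h - dep I01 I01 k <= 2 * e.
  move=> hh hk hke.
  have s1 : sup [set h u v - Picop u v | u in I01 & v in I01] <=
            sup [set k u v - Picop u v | u in I01 & v in I01] + e.
    apply: sup_image2_le => // u v Du Dv.
    have := hke _ _ Du Dv; rewrite ler_norml => /andP[_ hke1].
    by have := cop_sub_Picop_le_sup _ hk _ _ Du Dv; lra.
  have s2 : sup [set Picop u v - k u v | u in I01 & v in I01] <=
            sup [set Picop u v - h u v | u in I01 & v in I01] + e.
    apply: sup_image2_le => // u v Du Dv.
    have := hke _ _ Du Dv; rewrite ler_norml => /andP[_ hke1].
    by have := Picop_sub_cop_le_sup _ hh _ _ Du Dv; lra.
  by rewrite /dep; lra.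
move=> hf hg fg; rewrite ler_norml; apply/andP; split; last exact: half.
rewrite lerNl opprB; apply: half => // u v Du Dv.
by rewrite distrC; exact: fg.
Qed.

Lemma dep_transpose f : dep I01 I01 (fun u v => f v u) = dep I01 I01 f.
Proof.
rewrite /dep (image2_transpose _ _ _ (fun u v => f v u - Picop u v)).
rewrite (image2_transpose _ _ _ (fun u v => Picop u v - f v u)).
by congr (sup _ - sup _); apply: eq_image2 => u v _ _; rewrite /Picop (mulrC v).
Qed.

(** The excess of the reflected function over [Pi] at [(u, v)] is the deficit of [f] at
    [(1 - u, v)], and conversely. *)
Lemma dep_reflect f : dep I01 I01 (fun u v => v - f (1 - u) v) = - dep I01 I01 f.
Proof.
rewrite /dep opprB; congr (sup _ - sup _); apply/seteqP;
  by split => _ [u Du [v Dv <-]]; (exists (1 - u); first exact: I01_onem);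
  exists v => //; rewrite /Picop ?subKr; ring.
Qed.

(** * From pointwise to uniform convergence of copulas *)

Lemma I01_finite_net (e : R) : 0 < e -> exists (N : nat) (g : 'I_N -> R),
  (forall i, I01 (g i)) /\ (forall u, I01 u -> exists i, `|u - g i| <= e).
Proof.
(* The net is the grid [i / N], whose mesh is at most [e] because [N > 1 / e]. *)
move=> e0; pose N := (Num.trunc e^-1).+1.
have N0 : 0 < N%:R :> R by rewrite ltr0n.
have Ne : N%:R^-1 <= e.
  have e'0 : 0 <= e^-1 by rewrite invr_ge0 ltW.
  by rewrite invf_ple ?posrE// ltW//; case/andP: (truncn_itv e'0).
exists N.+1, (fun i => i%:R / N%:R); split.
  move=> i; rewrite /= in_itv/= divr_ge0// ler_pdivrMr// mul1r ler_nat.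
  by rewrite -ltnS ltn_ord.
move=> u /I01P/andP[u0 u1].
have uN0 : 0 <= u * N%:R by rewrite mulr_ge0// ltW.
have /andP[t1 t2] := truncn_itv uN0.
(* The grid point just below [u] is chosen; for [u = 1] its index is [N], hence [N.+1] points. *)
have tN : (Num.trunc (u * N%:R) < N.+1)%N.
  rewrite ltnS -(ler_nat R) (le_trans t1)// -[leRHS]mul1r ler_wpM2r//.
exists (Ordinal tN) => /=; rewrite (le_trans _ Ne)// ger0_norm.
  by rewrite lerBlDr -[X in X + _]mul1r -mulrDl ler_pdivlMr// nat1r ltW.
by rewrite subr_ge0 ler_pdivrMr.
Qed.

(** The common Lipschitz constant reduces uniform closeness to closeness on a finite grid. *)
Lemma cop_cvg_uniform (f_ : nat -> R -> R -> R) f :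
  (forall n, is_subcopula I01 I01 (f_ n)) -> is_subcopula I01 I01 f ->
  (forall u v, I01 u -> I01 v -> f_ n u v @[n --> \oo] --> f u v) ->
  forall e, 0 < e -> \forall n \near \oo,
    forall u v, I01 u -> I01 v -> `|f_ n u v - f u v| <= e.
Proof.
move=> hf_ hf cvf e e0.
(* Passing to a grid point costs [2e/5] for [f_ n] and [2e/5] for [f]; the remaining [e/5] is the
   error at that grid point. *)
have e50 : 0 < e / 5 by rewrite divr_gt0.
have [N [g [Ig netg]]] := I01_finite_net _ e50.
have : \forall n \near \oo, forall ij : 'I_N * 'I_N,
    `|f_ n (g ij.1) (g ij.2) - f (g ij.1) (g ij.2)| <= e / 5.
  apply: filter_forall => ij.
  exact: (cvgr_distC_le _ _ (cvf _ _ (Ig ij.1) (Ig ij.2))).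
apply: filterS => n hn u v Du Dv.
have [i ui] := netg _ Du; have [j vj] := netg _ Dv.
have h1 := cop_lipschitz _ (hf_ n) _ _ _ _ Du Dv (Ig i) (Ig j).
have h2 := cop_lipschitz _ hf _ _ _ _ Du Dv (Ig i) (Ig j).
have h3 := hn (i, j); rewrite /= in h3.
move: h1 h2 h3; rewrite !ler_norml; set a := _ + _ => /andP[? ?] /andP[? ?] /andP[? ?].
have : a <= e / 5 + e / 5 by exact: lerD.
by move=> ?; apply/andP; split; lra.
Qed.

Lemma dep_cvg (f_ : nat -> R -> R -> R) f :
  (forall n, is_subcopula I01 I01 (f_ n)) -> is_subcopula I01 I01 f ->
  (forall u v, I01 u -> I01 v -> f_ n u v @[n --> \oo] --> f u v) ->
  dep I01 I01 (f_ n) @[n --> \oo] --> dep I01 I01 f.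
Proof.
move=> hf_ hf cvf; apply/cvgrPdist_le => e e0.
have e20 : 0 < e / 2 by rewrite divr_gt0.
apply: filterS (cop_cvg_uniform _ _ hf_ hf cvf _ e20) => n hn.
rewrite distrC (le_trans (dep_dist _ _ _ (hf_ n) hf hn))// mulrC divfK//.
Qed.

(** * Attained suprema and the formula for [mu] *)

Lemma cop_has_maximum f : is_subcopula I01 I01 f ->
  (exists m, is_maximum [set f u v - Picop u v | u in I01 & v in I01] m) /\
  (exists m, is_maximum [set Picop u v - f u v | u in I01 & v in I01] m).
Proof.
move=> hf.
have Pilip (u v u' v' : R) : I01 u -> I01 v -> I01 u' -> I01 v' ->
    `|Picop u v - Picop u' v'| <= `|u - u'| + `|v - v'|.
  move=> /I01P Du /I01P Dv /I01P Du' /I01P Dv'.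
  have -> : Picop u v - Picop u' v' = (u - u') * v + u' * (v - v').
    by rewrite /Picop; ring.
  rewrite (le_trans (ler_normD _ _))// !normrM lerD//.
    by rewrite ler_piMr// ger0_norm; case/andP: Dv.
  by rewrite ler_piMl// ger0_norm; case/andP: Du'.
(* A difference of two functions with Lipschitz constant [1] has constant [2]. *)
split; apply: (@lipschitz2_has_maximum _ 2) => u v u' v' Du Dv Du' Dv';
  have := cop_lipschitz _ hf _ _ _ _ Du Dv Du' Dv';
  have := Pilip _ _ _ _ Du Dv Du' Dv'; rewrite !ler_norml;
  set a := _ + _ => /andP[? ?] /andP[? ?]; apply/andP; split; lra.
Qed.

Lemma copula_is_subcopula (C : copula R) : is_subcopula I01 I01 C.
Proof. by have := subcopP C; rewrite copula_dom1 copula_dom2. Qed.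

(** On the full square neither [M] nor [W] equals [Pi], as [dep] takes the values [1/4], [-1/4] and
    [0] on them; so only the first two branches of [mu] occur, and they agree. *)
Lemma mu_copula (C : copula R) : mu C = 4 * dep I01 I01 C.
Proof.
rewrite /mu copula_dom1 copula_dom2 dep_Mcop dep_Wcop.
have -> : `[< eq_on I01 I01 (@Mcop R) (@Picop R) >] = false.
  apply/asboolPn => /eq_dep; rewrite dep_Mcop dep_Picop; lra.
have -> : `[< eq_on I01 I01 (@Wcop R) (@Picop R) >] = false.
  apply/asboolPn => /eq_dep; rewrite dep_Wcop dep_Picop; lra.
rewrite !andbT; case: ifPn => [_|]; first by rewrite invrK mulrC.
rewrite -ltNge => /ltW ->.
by rewrite invrN invrK mulrNN mulrC.
Qed.

Lemma mu_eq_on (S S' : subcopula R) : dom1 S = dom1 S' -> dom2 S = dom2 S' ->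
  eq_on (dom1 S) (dom2 S) S S' -> mu S = mu S'.
Proof. by move=> e1 e2 /eq_dep; rewrite /mu -e1 -e2 => ->. Qed.

End UnitSquare.

(** * Probabilities as real numbers *)

Section RealProbability.
Context {R : realType} {d : measure_display} {T : measurableType d}
  (P : probability T R).
Implicit Types A B : set T.

Let p A := fine (P A).

Lemma pr_ge0 A : 0 <= p A.
Proof. exact: fine_ge0. Qed.

Lemma prT : p setT = 1.
Proof. by rewrite /p probability_setT. Qed.

Lemma pr0 : p set0 = 0.
Proof. by rewrite /p measure0. Qed.

Lemma pr_le A B : measurable A -> measurable B -> A `<=` B -> p A <= p B.
Proof.
move=> mA mB AB; apply: fine_le; rewrite ?fin_num_measure//.
by apply: le_measure; rewrite ?inE.
Qed.

Lemma prD A B : measurable A -> measurable B ->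
  p (A `\` B) = p A - p (A `&` B).
Proof.
move=> mA mB; rewrite /p measureD ?fineB ?fin_num_measure//; last first.
  by rewrite -ge0_fin_numE// fin_num_measure.
exact: measurableI.
Qed.

(** The alternating sum is the probability of [A2 \ A1] intersected with [B2 \ B1]. *)
Lemma pr_2increasing A1 A2 B1 B2 : measurable A1 -> measurable A2 ->
  measurable B1 -> measurable B2 -> A1 `<=` A2 -> B1 `<=` B2 ->
  0 <= p (A2 `&` B2) - p (A2 `&` B1) - p (A1 `&` B2) + p (A1 `&` B1).
Proof.
move=> mA1 mA2 mB1 mB2 A12 B12.
have : p ((A2 `&` B1) `\` A1) <= p ((A2 `&` B2) `\` A1).
  apply: pr_le; [exact: measurableD (measurableI _ _ mA2 mB1) mA1
    |exact: measurableD (measurableI _ _ mA2 mB2) mA1|].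
  by move=> t [[? /B12 ?] ?].
have AE B : (A2 `&` B) `&` A1 = A1 `&` B.
  by apply/seteqP; split => [t [[_ ?] ?]//|t [/[dup] /A12 ? ? ?]].
rewrite !prD ?AE//; [|exact: measurableI|exact: measurableI].
by lra.
Qed.

End RealProbability.

(** * Marginal and joint distribution functions *)

Section DistributionFunctions.
Context {R : realType} {d : measure_display} {T : measurableType d}
  {P : probability T R}.
Implicit Types X Y : {RV P >-> R}.
Local Notation p A := (fine (P A)).

(** An extended endpoint lets infinite thresholds obey the same formulas as finite ones. *)
Definition lower_ray (x : \bar R) : set R := [set r | (r%:E <= x)%E].

Definition le_event X (x : \bar R) : set T := X @^-1` lower_ray x.

Lemma lower_ray_fin (r : R) : lower_ray r%:E = `]-oo, r]%classic.
Proof. by apply/seteqP; split => s; rewrite /lower_ray/= in_itv/= lee_fin. Qed.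

Lemma lower_rayy : lower_ray +oo%E = setT.
Proof. by apply/seteqP; split => s //= _; rewrite /lower_ray/= leey. Qed.

Lemma lower_rayNy : lower_ray -oo%E = set0.
Proof. by apply/seteqP; split. Qed.

Lemma measurable_lower_ray x : measurable (lower_ray x).
Proof.
by case: x => [r||]; rewrite ?lower_ray_fin ?lower_rayy ?lower_rayNy.
Qed.

Lemma measurable_le_event X x : measurable (le_event X x).
Proof. by apply: measurable_funPTI => //; exact: measurable_lower_ray. Qed.

Lemma le_event_subset X x y : (x <= y)%E -> le_event X x `<=` le_event X y.
Proof. by move=> xy t Xx; exact: le_trans Xx xy. Qed.

Lemma dfE X x : df X x = p (le_event X x).
Proof.
case: x => [r||]; rewrite /df /le_event.
- by rewrite lower_ray_fin.
- by rewrite lower_rayy preimage_setT prT.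
- by rewrite lower_rayNy preimage_set0 pr0.
Qed.

Lemma joint_dfE X Y x y : joint_df X Y x y = p (le_event X x `&` le_event Y y).
Proof. by []. Qed.

Lemma joint_dfC X Y x y : joint_df X Y x y = joint_df Y X y x.
Proof. by rewrite !joint_dfE setIC. Qed.

Lemma df_itv01 X x : I01 (df X x).
Proof.
rewrite dfE /= in_itv/= pr_ge0/= -(prT P); apply: pr_le => //.
exact: measurable_le_event.
Qed.

Lemma le_df X x y : (x <= y)%E -> df X x <= df X y.
Proof.
move=> xy; rewrite !dfE; apply: pr_le; [exact: measurable_le_event..|].
exact: le_event_subset.
Qed.

Lemma joint_df_2increasing X Y x1 x2 y1 y2 : (x1 <= x2)%E -> (y1 <= y2)%E ->
  0 <= joint_df X Y x2 y2 - joint_df X Y x2 y1 - joint_df X Y x1 y2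
       + joint_df X Y x1 y1.
Proof.
move=> x12 y12; rewrite !joint_dfE; apply: pr_2increasing;
  [exact: measurable_le_event..|exact: le_event_subset|exact: le_event_subset].
Qed.

Lemma joint_df_ry X Y x : joint_df X Y x +oo%E = df X x.
Proof.
by rewrite joint_dfE dfE /(le_event Y) lower_rayy preimage_setT setIT.
Qed.

Lemma joint_df_rNy X Y x : joint_df X Y x -oo%E = 0.
Proof.
by rewrite joint_dfE /(le_event Y) lower_rayNy preimage_set0 setI0 pr0.
Qed.

(** * Sklar's theorem *)

Lemma joint_df_ge0 X Y x y : 0 <= joint_df X Y x y.
Proof. exact: pr_ge0. Qed.

Lemma joint_df_le_l X Y x y : joint_df X Y x y <= df X x.
Proof.
rewrite joint_dfE dfE; apply: pr_le => //.
- by apply: measurableI; exact: measurable_le_event.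
- exact: measurable_le_event.
Qed.

(** This makes the subcopula well defined. The strip between [x] and [x'] has mass
    [df X x' - df X x = 0], so its parts above and below [y], both of nonnegative mass, are null. *)
Lemma joint_df_eq_l X Y x x' y : df X x = df X x' ->
  joint_df X Y x y = joint_df X Y x' y.
Proof.
wlog xx' : x x' / (x <= x')%E => [H e|e].
  by have [/H|/ltW/H h] := leP x x'; [exact|rewrite h].
have := joint_df_2increasing X Y x x' y +oo%E xx' (leey _).
have := joint_df_2increasing X Y x x' -oo%E y xx' (leNye _).
rewrite !joint_df_ry !joint_df_rNy e => ? ?.
by apply/eqP; rewrite eq_le; apply/andP; split; lra.
Qed.

Lemma joint_df_eq X Y x x' y y' : df X x = df X x' -> df Y y = df Y y' ->
  joint_df X Y x y = joint_df X Y x' y'.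
Proof.
move=> ex ey; rewrite (joint_df_eq_l _ _ _ x')// joint_dfC.
by rewrite (joint_df_eq_l _ _ _ y')// joint_dfC.
Qed.

(* An arbitrary preimage of [u] under [df X], not the generalised inverse. *)
Definition quantile X (u : R) : \bar R := get [set x | df X x = u].

Lemma df_quantile X x : df X (quantile X (df X x)) = df X x.
Proof. by apply: (@getPex _ [set y | df X y = df X x]); exists x. Qed.

Lemma joint_df_is_subcopula X Y : is_subcopula (range (df X)) (range (df Y))
  (fun u v => joint_df X Y (quantile X u) (quantile Y v)).
Proof.
have dom (Z : {RV P >-> R}) :
    [set 0; 1] `<=` range (df Z) /\ range (df Z) `<=` I01.
  split; first by move=> _ [->|->]; [exists -oo%E|exists +oo%E].
  by move=> _ [x _ <-]; exact: df_itv01.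
(* Any choice of preimages is monotone here: reversed preimages would force [v <= u], as [df Z] is
   monotone. *)
have mono (Z : {RV P >-> R}) u v : range (df Z) u -> range (df Z) v -> u < v ->
    (quantile Z u <= quantile Z v)%E.
  move=> [x _ <-] [y _ <-]; apply: contraPT; rewrite -ltNge => /ltW/(le_df Z).
  by rewrite !df_quantile leNgt => /negP.
split; [exact: dom|exact: dom|..].
- move=> _ _ [x _ <-] [y _ <-]; rewrite joint_df_ge0/=.
  apply: le_trans (joint_df_le_l _ _ _ _) _.
  by case/andP: (I01P _ (df_itv01 X (quantile X (df X x)))).
- split=> [_ [x _ <-]|_ [y _ <-]].
    (* [0] is by computation [df Y -oo], so [quantile Y 0] may be traded for [-oo]; likewise [1] and
       [+oo] below. *)
    rewrite (joint_df_eq _ _ _ x _ -oo%E) ?joint_df_rNy ?df_quantile//.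
    exact: (df_quantile Y -oo%E).
  rewrite joint_dfC (joint_df_eq _ _ _ y _ -oo%E) ?joint_df_rNy ?df_quantile//.
  exact: (df_quantile X -oo%E).
- split=> [_ [x _ <-]|_ [y _ <-]].
    rewrite (joint_df_eq _ _ _ x _ +oo%E) ?joint_df_ry ?df_quantile//.
    exact: (df_quantile Y +oo%E).
  rewrite joint_dfC (joint_df_eq _ _ _ y _ +oo%E) ?joint_df_ry ?df_quantile//.
  exact: (df_quantile X +oo%E).
- move=> u1 u2 v1 v2 Du1 Du2 Dv1 Dv2.
  rewrite le_eqVlt => /predU1P[->|u12]; first by move=> _; lra.
  rewrite le_eqVlt => /predU1P[->|v12]; first by lra.
  by apply: joint_df_2increasing; exact: mono.
Qed.

Lemma sklar X Y : exists S : subcopula R, underlying X Y S.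
Proof.
exists (Subcopula (joint_df_is_subcopula X Y)); split=> //= x y.
by apply: joint_df_eq; rewrite df_quantile.
Qed.

(** [get] returns [mu S'] for some underlying [S']; both [S'] and [S] are determined by the joint
    distribution function on the product of the ranges. *)
Lemma mu_RV_underlying X Y S : underlying X Y S -> mu_RV X Y = mu S.
Proof.
move=> uS; rewrite /mu_RV.
have : [set m | exists2 S : subcopula R, underlying X Y S & m = mu S] (mu S).
  by exists S.
move=> /(@getI _ _ _) [S' uS' ->].
have [S'1 S'2 S'J] := uS'; have [S1 S2 SJ] := uS.
apply: mu_eq_on; rewrite ?S'1 ?S'2// => _ _ [x _ <-] [y _ <-].
by rewrite -S'J -SJ.
Qed.

(** * Continuous variables: the domain is the whole square *)

(** The values [0] and [1] are taken at the infinities; those between come from the limits there and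
    the intermediate value theorem. *)
Lemma range_df_continuous X : continuous_RV X -> range (df X) = I01.
Proof.
move=> cX; apply/seteqP; split; first by move=> _ [x _ <-]; exact: df_itv01.
move=> u /I01P /andP[]; rewrite le_eqVlt => /predU1P[<- _|u0].
  by exists -oo%E.
rewrite le_eqVlt => /predU1P[->|u1]; first by exists +oo%E.
have cNy : (fun r : R => df X r%:E) @ -oo --> (0 : R).
  exact/fine_cvg/cvg_cdfNy0.
have cy : (fun r : R => df X r%:E) @ +oo --> (1 : R).
  exact/fine_cvg/cvg_cdfy1.
have [a /ltW dfa] : exists a : R, df X a%:E < u.
  have : \forall a \near -oo, df X a%:E < u by exact: (cvgr_lt _ cNy).
  by move=> /filter_ex.
have [b /ltW dfb] : exists b : R, u < df X b%:E.
  have : \forall b \near +oo, u < df X b%:E by exact: (cvgr_gt _ cy).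
  by move=> /filter_ex.
(* If [b <= a], then [df X a <= u <= df X b <= df X a], and [a] is already a preimage of [u]. *)
wlog ab : a b dfa dfb / a <= b => [H|].
  have [/H|/ltW ba] := leP a b; first exact.
  exists a%:E => //; apply/eqP; rewrite eq_le dfa (le_trans dfb)//.
  by apply: le_df; rewrite lee_fin.
have ab' := le_trans dfa dfb.
have [c _ <-] : exists2 c, c \in `[a, b] & df X c%:E = u.
  apply: (@IVT _ (fun r => df X r%:E)) => //.
    exact: continuous_subspaceT.
  by rewrite (min_l ab') (max_r ab') dfa.
by exists c%:E.
Qed.

Lemma sklar_continuous X Y : continuous_RV X -> continuous_RV Y ->
  exists C : copula R, underlying X Y C.
Proof.
move=> cX cY; have [S uS] := sklar X Y; have [S1 S2 _] := uS.
have D1 : dom1 S = I01 by rewrite S1 range_df_continuous.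
have D2 : dom2 S = I01 by rewrite S2 range_df_continuous.
by exists (Copula D1 D2).
Qed.

(** This permits computing with any [f] representing the joint distribution, without first making it
    a [copula]: the ranges fill the square, so [f] agrees there with the copula. *)
Lemma mu_RV_dep X Y (f : R -> R -> R) : continuous_RV X -> continuous_RV Y ->
  (forall x y, joint_df X Y x y = f (df X x) (df Y y)) ->
  mu_RV X Y = 4 * dep I01 I01 f.
Proof.
move=> cX cY fJ; have [C uC] := sklar_continuous _ _ cX cY.
rewrite (mu_RV_underlying _ _ _ uC) mu_copula; congr (_ * _).
apply: eq_dep => u v; rewrite -{1}(range_df_continuous _ cX).
rewrite -(range_df_continuous _ cY) => -[x _ <-] [y _ <-].
by have [_ _ <-] := uC.
Qed.

(** * Comonotone, independent and reflected pairs *)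

Lemma joint_df_self X x y : joint_df X X x y = Mcop (df X x) (df X y).
Proof.
rewrite joint_dfE /Mcop; have [xy|/ltW xy] := leP x y.
  by rewrite setIidl ?min_l -?dfE// ?le_df//; exact: le_event_subset.
by rewrite setIidr ?min_r -?dfE// ?le_df//; exact: le_event_subset.
Qed.

Lemma joint_df_indep X Y x y : independent_RV X Y ->
  joint_df X Y x y = Picop (df X x) (df Y y).
Proof.
move=> /(_ _ _ (measurable_lower_ray x) (measurable_lower_ray y)) XY.
rewrite joint_dfE XY fineM ?dfE//; rewrite fin_num_measure//;
exact: measurable_le_event.
Qed.

Lemma measurable_eq_event X (x : \bar R) : measurable [set t | (X t)%:E = x].
Proof.
have -> : [set t | (X t)%:E = x] = X @^-1` [set r | r%:E = x] by [].
apply: measurable_funPTI => //; case: x => [r||].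
- rewrite (_ : [set _ | _] = [set r])//.
  by apply/seteqP; split => s /=; [case|move=> ->].
- by rewrite (_ : [set _ | _] = set0)//; apply/seteqP; split.
- by rewrite (_ : [set _ | _] = set0)//; apply/seteqP; split.
Qed.

(** The event [X = a] lies in [r < X <= a], whose mass [df X a - df X r] tends to [0] as [r]
    increases to [a]. *)
Lemma continuous_RV_eq0 X x : continuous_RV X -> p [set t | (X t)%:E = x] = 0.
Proof.
move=> cX; case: x => [a||]; last 2 first.
- by rewrite (_ : [set _ | _] = set0) ?pr0//; apply/seteqP; split.
- by rewrite (_ : [set _ | _] = set0) ?pr0//; apply/seteqP; split.
apply/eqP; rewrite eq_le pr_ge0 andbT; apply/ler_addgt0Pr => e e0.
rewrite add0r; near (a^'-) => r.
have ra : r < a by near: r; exact: nbhs_left_lt.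
have : `|df X a%:E - df X r%:E| <= e.
  near: r; apply: cvgr_dist_le => //; apply: cvg_at_left_filter; exact: cX.
apply: le_trans; rewrite (le_trans _ (ler_norm _))// !dfE.
have -> : le_event X r%:E = le_event X a%:E `&` le_event X r%:E.
  by rewrite setIidr//; apply: le_event_subset; rewrite lee_fin ltW.
rewrite -prD; [|exact: measurable_le_event..].
apply: pr_le; [exact: measurable_eq_event| |].
  by apply: measurableD; exact: measurable_le_event.
move=> t /= Xa; rewrite /le_event /lower_ray/= Xa; split => //.
by apply/negP; rewrite lee_fin -ltNge.
Unshelve. all: by end_near. Qed.

(** The complement of [- X <= x] is [X < - x], which differs from [X <= - x] only by the null event
    [X = - x]. *)
Lemma joint_df_oppl X Y x y : continuous_RV X ->
  joint_df (- X) Y x y = df Y y - joint_df X Y (- x)%E y.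
Proof.
move=> cX; rewrite !joint_dfE dfE.
set B := le_event Y y.
have mB : measurable B by exact: measurable_le_event.
have mN : measurable (le_event (- X) x) by exact: measurable_le_event.
have mX : measurable (le_event X (- x)%E) by exact: measurable_le_event.
have mE := measurable_eq_event X (- x)%E.
have NE : B `\` le_event (- X) x =
    (le_event X (- x)%E `&` B) `\` [set t | (X t)%:E = (- x)%E].
  apply/seteqP; split => t; rewrite /le_event /lower_ray/= EFinN leeNl.
    move=> [Bt /negP]; rewrite -ltNge => xX; split; first by rewrite ltW.
    by move=> e; rewrite e ltxx in xX.
  move=> [[xX Bt] /eqP ne]; split=> //; apply/negP.
  by rewrite -ltNge lt_neqAle ne.
have E0 : p (le_event X (- x)%E `&` B `&` [set t | (X t)%:E = (- x)%E]) = 0.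
  apply/eqP; rewrite eq_le pr_ge0 andbT -(continuous_RV_eq0 X (- x)%E cX).
  by apply: pr_le => //; do 2 ?apply: measurableI.
have := prD P _ _ mB mN.
rewrite NE prD//; last exact: measurableI.
by rewrite E0 (setIC B); lra.
Qed.

Lemma df_opp X x : continuous_RV X -> df (- X : {RV P >-> R}) x = 1 - df X (- x)%E.
Proof.
by move=> cX; have := joint_df_oppl _ X x +oo%E cX; rewrite !joint_df_ry.
Qed.

Lemma continuous_RV_opp X : continuous_RV X -> continuous_RV (- X : {RV P >-> R}).
Proof.
move=> cX r.
have -> : (fun r : R => df (- X : {RV P >-> R}) r%:E) = (fun r => 1 - df X (- r)%:E).
  by apply/funext => s; rewrite df_opp// EFinN.
apply: cvgB; first exact: cvg_cst.
by apply: (@continuous_comp _ _ _ -%R (fun s : R => df X s%:E));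
  [exact: opp_continuous|exact: cX].
Qed.

(** * Behaviour of [mu_RV] under exchange and sign change *)

Lemma mu_RV_sym X Y : continuous_RV X -> continuous_RV Y ->
  mu_RV X Y = mu_RV Y X.
Proof.
move=> cX cY; have [C uC] := sklar_continuous _ _ cX cY.
rewrite (mu_RV_underlying _ _ _ uC) mu_copula -dep_transpose.
rewrite (mu_RV_dep _ _ (fun u v => C v u))// => x y.
by rewrite joint_dfC; have [_ _ ->] := uC.
Qed.

Lemma mu_RV_oppl X Y : continuous_RV X -> continuous_RV Y ->
  mu_RV (- X) Y = - mu_RV X Y.
Proof.
move=> cX cY; have [C uC] := sklar_continuous _ _ cX cY.
rewrite (mu_RV_underlying _ _ _ uC) mu_copula -mulrN -dep_reflect.
apply: mu_RV_dep => //; first exact: continuous_RV_opp.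
(* With [u = df (- X) x], [df X (- x)] is [1 - u], so the pair [(- X, Y)] has copula
   [v - C (1 - u) v]. *)
move=> x y; rewrite joint_df_oppl// df_opp// subKr.
by have [_ _ ->] := uC.
Qed.

Lemma mu_RV_oppr X Y : continuous_RV X -> continuous_RV Y ->
  mu_RV X (- Y) = - mu_RV X Y.
Proof.
move=> cX cY; rewrite mu_RV_sym ?mu_RV_oppl ?(mu_RV_sym Y)//.
exact: continuous_RV_opp.
Qed.

Lemma mu_RV_self X : continuous_RV X -> mu_RV X X = 1.
Proof.
move=> cX; rewrite (mu_RV_dep _ _ (@Mcop R))//; last exact: joint_df_self.
by rewrite dep_Mcop mulfV.
Qed.

End DistributionFunctions.

(** * The formula for [mu] and the axioms of concordance *)

Theorem corollary2 (R : realType) :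
  (forall (d : measure_display) (T : measurableType d) (P : probability T R)
      (X Y : {RV P >-> R}) (C : copula R),
    continuous_RV X -> continuous_RV Y -> underlying X Y C ->
    exists m1 m2 : R,
      [/\ is_maximum [set C u v - Picop u v | u in `[0, 1]%classic & v in `[0, 1]%classic] m1,
          is_maximum [set Picop u v - C u v | u in `[0, 1]%classic & v in `[0, 1]%classic] m2,
          mu_RV X Y = mu C &
          mu C = 4 * (m1 - m2)]) /\
  measure_of_concordance (@mu_RV R) (fun C : copula R => mu C).
Proof.
split.
  move=> d T P X Y C cX cY uC.
  have [[m1 mm1] [m2 mm2]] := cop_has_maximum _ (copula_is_subcopula C).
  exists m1, m2; split=> //; first exact: mu_RV_underlying.
  by rewrite mu_copula /dep (sup_is_maximum _ _ _ mm1) (sup_is_maximum _ _ _ mm2).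
split.
- move=> d T P X Y cX cY; split; first exact: sklar_continuous.
  by move=> C; exact: mu_RV_underlying.
- move=> d T P X Y cX cY; have [C uC] := sklar_continuous _ _ cX cY.
  rewrite (mu_RV_underlying _ _ _ uC) mu_copula.
  by have := dep_bounds _ (copula_is_subcopula C); lra.
- move=> d T P X cX; split; first exact: mu_RV_self.
  (* The value at [(X, - X)] follows from the sign rule, with no computation for [W]. *)
  by rewrite mu_RV_oppr// mu_RV_self.
- by move=> d T P X Y; exact: mu_RV_sym.
- move=> d T P X Y cX cY iXY.
  rewrite (mu_RV_dep _ _ (@Picop R)) ?dep_Picop ?mulr0// => x y.
  exact: joint_df_indep.
- by move=> d T P X Y cX cY; split; [exact: mu_RV_oppl|exact: mu_RV_oppr].
- move=> C1 C2 C12; rewrite !mu_copula ler_pM2l//.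
  by apply: le_dep => //; exact: copula_is_subcopula.
- move=> d_ T_ P_ X_ Y_ C_ C _ _ _ cvC.
  under eq_fun do rewrite mu_copula.
  rewrite mu_copula; apply: cvgMr; apply: dep_cvg => //.
    by move=> n; exact: copula_is_subcopula.
  exact: copula_is_subcopula.
Qed.
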